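(* Let $X$ be a bounded real-valued random variable on a non-atomic probability space $(\Omega,\mathcal F,\mathbb P)$, and let $\mathbf X=(X_1,\dots,X_p)\in\mathcal A(X)$ be an allocation of $X$. There exists a comonotone allocation in $\mathcal A(X)$ that dominates $\mathbf X$. Moreover, if $\mathbf X$ is not comonotone, then there exists an allocation in $\mathcal A(X)$ that strictly dominates $\mathbf X$.
   Context: $\mathcal A(X)=\{\mathbf Y=(Y_1,\dots,Y_p): Y_i\in L^\infty(\Omega,\mathbb R),\ \sum_{i=1}^pY_i=X\}$, where $p\ge1$ is fixed. For bounded real random variables $U,V$: $U\succcurlyeq V$ ($U$ dominates $V$ for the concave order) if $\mathbb E(\varphi(U))\le\mathbb E(\varphi(V))$ for every convex $\varphi:\mathbb R\to\mathbb R$; $U$ strictly dominates $V$ if, in addition, $\mathbb E(\varphi(U))<\mathbb E(\varphi(V))$ for some convex $\varphi$. For $\mathbf X,\mathbf Y\in\mathcal A(X)$, $\mathbf X$ dominates $\mathbf Y$ if $X_i\succcurlyeq Y_i$ for every $i$; it strictly dominates $\mathbf Y$ if, in addition, $X_i$ strictly dominates $Y_i$ for some $i$. $(X_1,\dots,X_p)$ is comonotone if for all $i,j\in\{1,\dots,p\}$, $(X_i(\omega')-X_i(\omega))(X_j(\omega')-X_j(\omega))\ge0$ for $\mathbb P\otimes\mathbb P$-a.e. $(\omega,\omega')\in\Omega^2$. *)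

(* Defs.v *)
From mathcomp Require Import all_boot all_order all_algebra.
From mathcomp Require Import all_classical all_reals all_analysis.

Set Implicit Arguments.
Unset Strict Implicit.
Unset Printing Implicit Defensive.

Import Order.TTheory GRing.Theory Num.Theory.
Import numFieldNormedType.Exports.

Local Open Scope classical_set_scope.
Local Open Scope ring_scope.

Section Definitions.
Context {d : measure_display} {T : measurableType d} {R : realType}.
Variable P : probability T R.

Definition atom (A : set T) : Prop :=
  [/\ measurable A, (0 < P A)%E &
      forall B, measurable B -> B `<=` A -> P B = 0%E \/ P B = P A].

Definition non_atomic : Prop := forall A : set T, ~ atom A.

(* Elements of L^oo are represented by measurable, essentially bounded
   functions, so equality in L^oo is almost sure equality. *)
Definition allocation (p : nat) (X : T -> R) (Y : 'I_p -> T -> R) : Prop :=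
  (forall i, Y i \in Lfun P +oo%E) /\
  (\forall w \ae P, \sum_(i < p) Y i w = X w).

Definition dominates (U V : T -> R) : Prop :=
  forall phi : R -> R, convex_function [set: R^o] phi ->
    ('E_P[phi \o U] <= 'E_P[phi \o V])%E.

Definition strictly_dominates (U V : T -> R) : Prop :=
  dominates U V /\
  exists phi : R -> R, convex_function [set: R^o] phi /\
    ('E_P[phi \o U] < 'E_P[phi \o V])%E.

Definition alloc_dominates (p : nat) (X Y : 'I_p -> T -> R) : Prop :=
  forall i, dominates (X i) (Y i).

Definition alloc_strictly_dominates (p : nat) (X Y : 'I_p -> T -> R) : Prop :=
  alloc_dominates X Y /\ exists i, strictly_dominates (X i) (Y i).

Definition comonotone (p : nat) (X : 'I_p -> T -> R) : Prop :=
  forall i j : 'I_p, \forall w \ae (P \x P)%E,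
    0 <= (X i w.2 - X i w.1) * (X j w.2 - X j w.1).

End Definitions.

(* Main.v *)
Require Import Defs.
From mathcomp Require Import all_boot all_order all_algebra.
From mathcomp Require Import all_classical all_reals all_analysis.
From mathcomp Require Import measurable_realfun ess_sup_inf.
From mathcomp Require Import ring lra.

(* If [X_i] and [X_j] fail to be comonotone, there are thresholds [q], [r], a margin [e]
   and two events of positive probability: on [A], [X_i] is at least [e] below [q] and
   [X_j] at least [e] above [r]; on [B] it is the other way round. Moving a little mass
   from [j] to [i] on [A] and back on [B], with zero mean, brings the values of [X_i]
   closer to [q] and those of [X_j] closer to [r]; comparing a convex function with its
   supporting line at [q] (resp. [r]) shows that every convex expectation decreases, the
   second moment strictly. This gives the strict domination. For the comonotone
   allocation, minimize the sum of the second moments among the uniformly bounded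
   allocations that dominate the given one: a minimizer exists because this set is convex
   and closed under almost sure limits, and by the previous step it is comonotone. *)

Set Implicit Arguments.
Unset Strict Implicit.
Unset Printing Implicit Defensive.

Import Order.TTheory GRing.Theory Num.Theory.
Import numFieldNormedType.Exports.

Local Open Scope classical_set_scope.
Local Open Scope ring_scope.

(** * Convex functions on the real line *)

Section Convex.
Context {R : realType}.
Implicit Types (phi : R -> R) (x y m t : R).

(** The weight in [convex_function] lives in an interval type; a real weight with explicit bounds
    can be handed to the arithmetic tactics. *)
Lemma convexP phi : convex_function [set: R^o] phi <->
  forall t x y, 0 <= t <= 1 ->
    phi (t * x + (1 - t) * y) <= t * phi x + (1 - t) * phi y.
Proof.
split=> [cphi t x y /andP[t0 t1]|cphi t x y _ _]; last first.
  by have := cphi t%:num x y; rewrite ge0 le1 => /(_ isT).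
have t01 : Itv.spec (@Itv.num_sem R) (Itv.Real `[0%Z, 1%Z]) t.
  by apply/and3P; split; rewrite ?in_itv /= ?t0 ?t1 ?num_real.
have := @cphi (Itv.mk t01) x y.
by rewrite !in_setT => /(_ isT isT).
Qed.

Lemma convex_sqr : convex_function [set: R^o] (fun x : R => x ^+ 2).
Proof.
apply/convexP => t x y /andP[t0 t1].
have : 0 <= t * (1 - t) * (x - y) ^+ 2.
  by rewrite mulr_ge0 ?sqr_ge0// mulr_ge0// subr_ge0.
nra.
Qed.

(** The denominator [b - a] is cleared, so that later uses are polynomial inequalities. *)
Lemma convex_chord phi a x b : convex_function [set: R^o] phi ->
  a < b -> a <= x <= b ->
  (b - a) * phi x <= (b - x) * phi a + (x - a) * phi b.
Proof.
move=> /convexP cphi ab /andP[ax xb].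
have ba : 0 < b - a by lra.
have := cphi ((b - x) / (b - a)) a b.
have -> : 0 <= (b - x) / (b - a) <= 1.
  by rewrite divr_ge0 ?ler_pdivrMr//; lra.
have -> : 1 - (b - x) / (b - a) = (x - a) / (b - a) by field; lra.
have -> : (b - x) / (b - a) * a + (x - a) / (b - a) * b = x by field; lra.
move=> /(_ isT); rewrite -(ler_pM2l ba) => /le_trans; apply.
by rewrite le_eqVlt; apply/orP; left; apply/eqP; field; lra.
Qed.

(** The slope [s] is the left derivative at [m], taken as the supremum of the slopes of chords
    ending at [m]; each chord starting at [m] has a slope above all of these. *)
Lemma convex_subgradient phi m : convex_function [set: R^o] phi ->
  exists s, forall x, phi m + s * (x - m) <= phi x.
Proof.
move=> cphi.
pose S := [set (phi m - phi x) / (m - x) | x in [set x | x < m]].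
have Sub y : m < y -> ubound S ((phi y - phi m) / (y - m)).
  move=> my _ [x /= xm <-].
  rewrite ler_pdivrMr ?subr_gt0// mulrAC ler_pdivlMr ?subr_gt0//.
  have := @convex_chord phi x m y cphi; rewrite (lt_trans xm my) (ltW xm) (ltW my).
  move=> /(_ isT isT); lra.
have S0 : S !=set0 by exists ((phi m - phi (m - 1)) / (m - (m - 1))); exists (m - 1) => //=; lra.
have hS : has_sup S by split => //; exists ((phi (m+1) - phi m) / (m + 1 - m)); apply: Sub; lra.
exists (sup S) => x.
have [xm|mx|->] := ltgtP x m; last by rewrite subrr mulr0 addr0.
- have : (phi m - phi x) / (m - x) <= sup S by apply: ub_le_sup; [exact: hS.2|exists x].
  rewrite ler_pdivrMr ?subr_gt0//; lra.
- have : sup S <= (phi x - phi m) / (x - m) by apply: ge_sup => //; exact: Sub.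
  rewrite ler_pdivlMr ?subr_gt0//; lra.
Qed.

Lemma convex_continuous phi : convex_function [set: R^o] phi -> continuous phi.
Proof.
move=> cphi m; have [s hs] := convex_subgradient m cphi.
(* A Lipschitz constant at the single point [m], at distance at most 1: the supporting line bounds
   [phi] from below, the chords from [m] to [m + 1] and [m - 1] bound it from above. The summand 1
   makes [L] positive. *)
pose L := 1 + `|s| + `|phi (m + 1) - phi m| + `|phi (m - 1) - phi m|.
have L0 : 0 < L.
  by rewrite /L !ltr_wpDr.
have lip x : `|x - m| <= 1 -> `|phi x - phi m| <= L * `|x - m|.
  move=> xm1.
  have := hs x; have : - (`|s| * `|x - m|) <= s * (x - m) by rewrite -normrM lerNnormlW.
  move=> h1 h2.
  have h3 := ler_norm (phi (m + 1) - phi m).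
  have h4 := ler_norm (phi (m - 1) - phi m).
  have n1 := normr_ge0 s.
  have n2 := normr_ge0 (phi (m + 1) - phi m).
  have n3 := normr_ge0 (phi (m - 1) - phi m).
  have n4 := normr_ge0 (x - m).
  rewrite ler_norml; apply/andP; split; first by rewrite /L; nra.
  have [mx|xm] := leP m x.
    move: xm1 h1 h2 n4; rewrite ger0_norm ?subr_ge0// => xm1 h1 h2 n4.
    have := @convex_chord phi m x (m + 1) cphi.
    have -> : m < m + 1 by lra.
    have -> : m <= x <= m + 1 by lra.
    move=> /(_ isT isT) ?; rewrite /L; nra.
  move: xm1 h1 h2 n4; rewrite ltr0_norm ?subr_lt0// => xm1 h1 h2 n4.
  have := @convex_chord phi (m - 1) x m cphi.
  have -> : m - 1 < m by lra.
  have -> : m - 1 <= x <= m by lra.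
  move=> /(_ isT isT) ?; rewrite /L; nra.
apply/cvgrPdist_le => e e0.
near=> x.
have xm1 : `|x - m| <= 1.
  by rewrite distrC; near: x; apply: (@cvgrPdist_le _ _ _ (nbhs m) _ id m).1 => //; exact: cvg_id.
rewrite distrC; apply: (le_trans (lip _ xm1)); rewrite mulrC -ler_pdivlMr// distrC.
near: x; apply: (@cvgrPdist_le _ _ _ (nbhs m) _ id m).1; first exact: cvg_id.
by rewrite divr_gt0.
Unshelve. all: by end_near. Qed.

Lemma convex_measurable phi : convex_function [set: R^o] phi ->
  measurable_fun [set: R] phi.
Proof. by move=> /convex_continuous; exact: continuous_measurable_fun. Qed.

(** A chord bounds [phi] from above and the supporting line at 0 from below. The chord ends at
    [M + 1] rather than [M], which keeps it nondegenerate when [M] is 0. *)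
Lemma convex_bounded phi M : convex_function [set: R^o] phi ->
  exists K, forall x, `|x| <= M -> `|phi x| <= K.
Proof.
move=> cphi; have [M0|M0] := ltP M 0.
  by exists 0 => x xM; have := normr_ge0 x; lra.
have [s hs] := convex_subgradient 0 cphi.
exists (`|phi 0| + `|s| * M + `|phi (M + 1)| + `|phi (- (M + 1))|) => x xM.
have := xM; rewrite ler_norml => /andP[x1 x2].
have := @convex_chord phi (- (M + 1)) x (M + 1) cphi.
have -> : - (M + 1) < M + 1 by lra.
have -> : - (M + 1) <= x <= M + 1 by lra.
move=> /(_ isT isT) h.
have h1 := ler_norm (phi (M + 1)).
have h2 := ler_norm (phi (- (M + 1))).
have h3 : - `|phi 0| <= phi 0 by rewrite lerNnormlW.
have h4 : - (`|s| * `|x|) <= s * x by rewrite -normrM lerNnormlW.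
have n0 := normr_ge0 (phi 0).
have n1 := normr_ge0 s.
have n2 := normr_ge0 (phi (M + 1)).
have n3 := normr_ge0 (phi (- (M + 1))).
have := hs x; rewrite subr0 => h5.
have h6 : `|s| * `|x| <= `|s| * M by rewrite ler_wpM2l.
rewrite ler_norml; apply/andP; split; first lra.
have : (M + 1 + (M + 1)) * phi x <= (M + 1 + (M + 1)) * (`|phi (M + 1)| + `|phi (- (M + 1))|).
  nra.
rewrite ler_pM2l; last lra.
have : 0 <= `|s| * M by rewrite mulr_ge0.
lra.
Qed.

(* The hypothesis on [h] says that [x + h] lies between [x] and [q]. *)
Lemma convex_move_le phi q s x h : convex_function [set: R^o] phi ->
  (forall y, phi q + s * (y - q) <= phi y) ->
  0 <= h * (q - x - h) -> phi (x + h) <= phi x + s * h.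
Proof.
move=> cphi hs hxq; have hx := hs x.
have [h0|h0|->] := ltgtP h 0; last by rewrite mulr0 !addr0.
  have qx : q <= x + h by move: hxq; rewrite nmulr_rge0//; lra.
  (* The chord bounds [phi (x + h)] by an average of [phi q] and [phi x], and the supporting line at
     [q] gives [phi q <= phi x - s * (x - q)]. *)
  have := @convex_chord phi q (x + h) x cphi.
  have -> : q < x by lra.
  have -> : q <= x + h <= x by lra.
  move=> /(_ isT isT) H.
  have : (x - q) * phi (x + h) <= (x - q) * (phi x + s * h) by nra.
  by rewrite ler_pM2l//; lra.
have qx : x + h <= q by move: hxq; rewrite pmulr_rge0//; lra.
have := @convex_chord phi x (x + h) q cphi.
have -> : x < q by lra.
have -> : x <= x + h <= q by lra.
move=> /(_ isT isT) H.
have : (q - x) * phi (x + h) <= (q - x) * (phi x + s * h) by nra.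
by rewrite ler_pM2l//; lra.
Qed.

End Convex.

(** * Bounded random variables, their integrals and the concave order *)

Section BoundedVariables.
Context {d : measure_display} {T : measurableType d} {R : realType}.
Variable P : probability T R.
Implicit Types (U V : T -> R) (phi : R -> R).

(** The bound holds everywhere, not just almost surely, so that integrability is immediate and
    pointwise estimates can be integrated directly. *)
Definition bounded_rv U :=
  measurable_fun setT U /\ exists M, forall w, `|U w| <= M.

Lemma bounded_rv_cst (c : R) : bounded_rv (fun=> c).
Proof. by split => //; exists `|c|. Qed.

Lemma bounded_rv_indic (A : set T) : measurable A -> bounded_rv (\1_A : T -> R).
Proof.
move=> mA; split; first exact: measurable_indic.
by exists 1 => w; rewrite indicE; case: (_ \in _); rewrite ?normr1 ?normr0.
Qed.

Lemma bounded_rvD U V : bounded_rv U -> bounded_rv V ->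
  bounded_rv (fun w => U w + V w).
Proof.
move=> [mU [M hM]] [mV [N hN]]; split; first exact: measurable_funD.
by exists (M + N) => w; rewrite (le_trans (ler_normD _ _))// lerD.
Qed.

Lemma bounded_rvM U V : bounded_rv U -> bounded_rv V ->
  bounded_rv (fun w => U w * V w).
Proof.
move=> [mU [M hM]] [mV [N hN]]; split; first exact: measurable_funM.
by exists (M * N) => w; rewrite normrM ler_pM.
Qed.

Lemma bounded_rvB U V : bounded_rv U -> bounded_rv V ->
  bounded_rv (fun w => U w - V w).
Proof.
move=> bU bV; have := bounded_rvD bU (bounded_rvM (bounded_rv_cst (-1)) bV).
by congr bounded_rv; apply/funext => w; rewrite mulN1r.
Qed.

Lemma bounded_rvX2 U : bounded_rv U -> bounded_rv (fun w => U w ^+ 2).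
Proof.
move=> bU; have := bounded_rvM bU bU.
by congr bounded_rv; apply/funext => w; rewrite expr2.
Qed.

Lemma bounded_rv_norm U : bounded_rv U -> bounded_rv (fun w => `|U w|).
Proof.
move=> [mU [M hM]]; split; first exact: measurableT_comp.
by exists M => w; rewrite normr_id.
Qed.

Lemma bounded_rv_convex phi U : convex_function [set: R^o] phi ->
  bounded_rv U -> bounded_rv (phi \o U).
Proof.
move=> cphi [mU [M hM]]; split.
  by apply: measurableT_comp => //; exact: convex_measurable.
by have [K hK] := convex_bounded M cphi; exists K => w; exact/hK/hM.
Qed.

Lemma bounded_rv_integrable U : bounded_rv U -> P.-integrable setT (EFin \o U).
Proof.
move=> [mU [M hM]]; apply: measurable_bounded_integrable => //.
  by rewrite [X in (X < _)%E](_ : _ = 1%E) ?ltry//; exact: probability_setT.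
exists M; split; rewrite ?num_real// => N MN w _ /=.
  exact: le_trans (hM w) (ltW MN).
Qed.

Lemma EFin_Rintegral_bounded U : bounded_rv U ->
  (\int[P]_w U w)%:E = (\int[P]_w (U w)%:E)%E.
Proof.
by move=> bU; rewrite /Rintegral fineK// integrable_fin_num//; exact: bounded_rv_integrable.
Qed.

Lemma expectation_bounded_rv U : bounded_rv U -> ('E_P[U])%E = (\int[P]_w U w)%:E.
Proof. by move=> bU; rewrite unlock EFin_Rintegral_bounded. Qed.

Lemma RintegralD_bounded U V : bounded_rv U -> bounded_rv V ->
  \int[P]_w (U w + V w) = \int[P]_w U w + \int[P]_w V w.
Proof. by move=> bU bV; rewrite RintegralD//; exact: bounded_rv_integrable. Qed.

Lemma RintegralB_bounded U V : bounded_rv U -> bounded_rv V ->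
  \int[P]_w (U w - V w) = \int[P]_w U w - \int[P]_w V w.
Proof. by move=> bU bV; rewrite RintegralB//; exact: bounded_rv_integrable. Qed.

Lemma RintegralZ_bounded c U : bounded_rv U ->
  \int[P]_w (c * U w) = c * \int[P]_w U w.
Proof. by move=> bU; rewrite RintegralZl//; exact: bounded_rv_integrable. Qed.

Lemma Rintegral_indic (A : set T) : measurable A ->
  \int[P]_w (\1_A w : R) = fine (P A).
Proof. by move=> mA; rewrite /Rintegral integral_indic// setIT. Qed.

Lemma le_Rintegral_bounded U V : bounded_rv U -> bounded_rv V ->
  (forall w, U w <= V w) -> \int[P]_w U w <= \int[P]_w V w.
Proof. by move=> bU bV UV; apply: le_Rintegral => //; exact: bounded_rv_integrable. Qed.

Lemma expectation_ae_eq U V : measurable_fun setT U -> measurable_fun setT V ->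
  (\forall w \ae P, U w = V w) -> ('E_P[U] = 'E_P[V])%E.
Proof.
move=> mU mV UV; rewrite unlock; apply: ae_eq_integral => //.
- exact/measurable_EFinP.
- exact/measurable_EFinP.
- by apply: filterS UV => w ->.
Qed.

Lemma dominates_refl U : dominates P U U.
Proof. by move=> phi _. Qed.

Lemma dominates_trans U V W : dominates P U V -> dominates P V W -> dominates P U W.
Proof. by move=> UV VW phi cphi; exact: le_trans (UV _ cphi) (VW _ cphi). Qed.

Lemma dominates_bounded U V : bounded_rv U -> bounded_rv V ->
  dominates P U V <-> forall phi, convex_function [set: R^o] phi ->
    \int[P]_w phi (U w) <= \int[P]_w phi (V w).
Proof.
move=> bU bV; split => UV phi cphi.
  have := UV _ cphi; rewrite !expectation_bounded_rv ?lee_fin//; exact: bounded_rv_convex.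
rewrite !expectation_bounded_rv ?lee_fin; [exact: UV| |]; exact: bounded_rv_convex.
Qed.

Lemma dominates_ae_eqr U V V' : measurable_fun setT V -> measurable_fun setT V' ->
  (\forall w \ae P, V w = V' w) -> dominates P U V -> dominates P U V'.
Proof.
move=> mV mV' VV' UV phi cphi; have mphi := convex_measurable cphi.
apply: (le_trans (UV _ cphi)); rewrite (@expectation_ae_eq _ (phi \o V'))//.
- exact: measurableT_comp.
- exact: measurableT_comp.
- by apply: filterS VV' => w /= ->.
Qed.

Lemma bounded_rv_Lfun U : bounded_rv U -> U \in Lfun P +oo%E.
Proof.
move=> [mU [M hM]]; rewrite inE; apply/andP; split; first by rewrite inE.
rewrite inE /= /finite_norm unlock; case: ifPn => // _.
apply: le_lt_trans (ltry M); apply/ess_supP.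
by apply: aeW => w /=; rewrite lee_fin.
Qed.

Lemma Lfun_bounded U : U \in Lfun P +oo%E ->
  measurable_fun setT U /\ exists M, \forall w \ae P, `|U w| <= M.
Proof.
rewrite inE => /andP[]; rewrite inE => mU; rewrite inE /= /finite_norm unlock => hU.
split => //; apply: ess_supr_bounded.
(* The norm of exponent [+oo] is the essential supremum only on a space of positive mass; here the
   mass is 1. *)
move: hU; case: ifPn => //; by rewrite [X in (0 < X)%E]probability_setT lte01.
Qed.

(* The amplitudes are weighted by [P B] and [P A] so that the transfer has mean zero
   without requiring [A] and [B] to be equiprobable. *)
Definition transfer U (A B : set T) (e : R) : T -> R :=
  fun w => U w + (e * fine (P B) * \1_A w - e * fine (P A) * \1_B w).

Lemma bounded_rv_transfer U A B e : bounded_rv U -> measurable A -> measurable B ->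
  bounded_rv (transfer U A B e).
Proof.
move=> bU mA mB; apply: bounded_rvD => //; apply: bounded_rvB.
- by apply: (bounded_rvM (bounded_rv_cst _)); exact: bounded_rv_indic.
- by apply: (bounded_rvM (bounded_rv_cst _)); exact: bounded_rv_indic.
Qed.

(** * Effect of a mean-zero transfer on one variable *)

Section Transfer.
Variables (U : T -> R) (A B : set T) (q e : R).
Hypotheses (bU : bounded_rv U) (mA : measurable A) (mB : measurable B).
Hypotheses (e0 : 0 < e) (UA : forall w, A w -> U w <= q - e)
  (UB : forall w, B w -> q + e <= U w).

Let a := fine (P A).
Let b := fine (P B).

Let fineP_01 (C : set T) : measurable C -> 0 <= fine (P C) <= 1.
Proof.
move=> mC; rewrite fine_ge0//= -lee_fin fineK ?probability_le1//.
by rewrite ge0_fin_numE// (le_lt_trans (probability_le1 _ _))// ltry.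
Qed.

Let bZ : bounded_rv (transfer U A B e).
Proof. exact: bounded_rv_transfer. Qed.

(** The margin [e] on both sides of [q] makes [A] and [B] disjoint, which rules out a fourth
    case. *)
Let transferP w : [/\ ~ A w, ~ B w & transfer U A B e w = U w] \/
  [/\ A w, ~ B w & transfer U A B e w = U w + e * b ] \/
  [/\ ~ A w, B w & transfer U A B e w = U w - e * a ].
Proof.
rewrite /transfer !indicE.
have [Aw|Aw] := pselect (A w); have [Bw|Bw] := pselect (B w).
- by exfalso; move: e0 (UA Aw) (UB Bw); lra.
- by right; left; split => //; rewrite (mem_set Aw) (memNset Bw) mulr1 mulr0 subr0.
- by right; right; split => //; rewrite (mem_set Bw) (memNset Aw) mulr1 mulr0 sub0r.
- by left; split => //; rewrite (memNset Aw) (memNset Bw) !mulr0 subrr addr0.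
Qed.

(** Since [P A] and [P B] are at most 1, values move by at most [e] towards [q] and never cross it.
    As [A] and [B] are nonempty, [U] takes values on both sides of [q], so [q] itself lies between
    [- M] and [M]. *)
Lemma transfer_bounded_by M : A !=set0 -> B !=set0 -> (forall w, `|U w| <= M) ->
  forall w, `|transfer U A B e w| <= M.
Proof.
move=> [wA AwA] [wB BwB] UM w.
have := fineP_01 mA; have := fineP_01 mB; rewrite -/a -/b => /andP[b0 b1] /andP[a0 a1].
have := UM w; have := UM wA; have := UM wB; rewrite !ler_norml.
have := UA AwA; have := UB BwB => ? ? /andP[? ?] /andP[? ?] /andP[? ?].
have [[_ _ ->]|[[Aw _ ->]|[_ Bw ->]]] := transferP w; first by apply/andP; split.
- have eb : e * b <= e by rewrite ler_piMr// ltW.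
  have eb0 : 0 <= e * b by rewrite mulr_ge0// ltW.
  by have := UA Aw => ?; apply/andP; split; lra.
- have ea : e * a <= e by rewrite ler_piMr// ltW.
  have ea0 : 0 <= e * a by rewrite mulr_ge0// ltW.
  by have := UB Bw => ?; apply/andP; split; lra.
Qed.

Let Rintegral_bump c : \int[P]_w (c * (e * b * \1_A w - e * a * \1_B w)) = 0.
Proof.
have bA := bounded_rv_indic mA; have bB := bounded_rv_indic mB.
rewrite RintegralZ_bounded ?RintegralB_bounded ?RintegralZ_bounded ?Rintegral_indic//.
- by rewrite -/a -/b; ring.
- exact: (bounded_rvM (bounded_rv_cst _)).
- exact: (bounded_rvM (bounded_rv_cst _)).
- apply: bounded_rvB; exact: (bounded_rvM (bounded_rv_cst _)).
Qed.

Let bounded_rv_bump c : bounded_rv (fun w => c * (e * b * \1_A w - e * a * \1_B w)).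
Proof.
apply: (bounded_rvM (bounded_rv_cst _)).
apply: bounded_rvB; apply: (bounded_rvM (bounded_rv_cst _)); exact: bounded_rv_indic.
Qed.

Lemma transfer_dominates : dominates P (transfer U A B e) U.
Proof.
apply/dominates_bounded => // phi cphi.
have [s hs] := convex_subgradient q cphi.
have := fineP_01 mA; have := fineP_01 mB; rewrite -/a -/b => /andP[b0 b1] /andP[a0 a1].
(* The slope [s] times the increment has integral zero; adding it on the right reduces the claim to
   a pointwise inequality, which is [convex_move_le] on [A] and on [B]. *)
rewrite -[leRHS]addr0 -(Rintegral_bump s) -RintegralD_bounded//; last first.
  exact: bounded_rv_convex.
apply: le_Rintegral_bounded.
- exact: bounded_rv_convex.
- by apply: bounded_rvD => //; exact: bounded_rv_convex.
move=> w; rewrite !indicE.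
have [[Aw Bw ->]|[[Aw Bw ->]|[Aw Bw ->]]] := transferP w.
- by rewrite (memNset Aw) (memNset Bw) !mulr0 subrr mulr0 addr0.
- rewrite (mem_set Aw) (memNset Bw) mulr1 mulr0 subr0; apply: (convex_move_le cphi hs).
  have eb : e * b <= e by rewrite ler_piMr// ltW.
  by have := UA Aw => ?; rewrite !mulr_ge0// ?(ltW e0)//; lra.
- rewrite (mem_set Bw) (memNset Aw) mulr1 mulr0 sub0r.
  rewrite -[U w - _]/(U w + - _); apply: (convex_move_le cphi hs).
  have ea : e * a <= e by rewrite ler_piMr// ltW.
  have := UB Bw => ?; rewrite mulNr oppr_ge0 mulr_ge0_le0 ?mulr_ge0 ?(ltW e0)//; lra.
Qed.

Lemma transfer_sqr_lt : (0 < P A)%E -> (0 < P B)%E ->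
  \int[P]_w (transfer U A B e w ^+ 2) < \int[P]_w (U w ^+ 2).
Proof.
move=> PA PB.
have fgt0 (C : set T) : measurable C -> (0 < P C)%E -> 0 < fine (P C).
  move=> mC PC; rewrite fine_gt0// PC/= (le_lt_trans (probability_le1 _ _))//.
  by rewrite ltry.
have a0 : 0 < a by exact: fgt0.
have b0 : 0 < b by exact: fgt0.
have /andP[_ a1] := fineP_01 mA; have /andP[_ b1] := fineP_01 mB.
have bA := bounded_rv_indic mA.
pose c := e * (e * b).
have h : \int[P]_w (transfer U A B e w ^+ 2) <=
    \int[P]_w (U w ^+ 2 + 2 * q * (e * b * \1_A w - e * a * \1_B w) - c * \1_A w).
  apply: le_Rintegral_bounded.
  - exact: bounded_rvX2.
  - apply: bounded_rvB; last exact: (bounded_rvM (bounded_rv_cst _)).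
    by apply: bounded_rvD => //; exact: bounded_rvX2.
  move=> w; rewrite !indicE.
  have [[Aw Bw ->]|[[Aw Bw ->]|[Aw Bw ->]]] := transferP w.
  - by rewrite (memNset Aw) (memNset Bw) !mulr0 subrr mulr0 addr0 subr0.
  - rewrite (mem_set Aw) (memNset Bw) !(mulr1, mulr0, subr0).
    have eb : 0 <= e * b * (2 * (q - e - U w) + (e - e * b)).
      have eb : e * b <= e by rewrite ler_piMr// ltW.
      by have := UA Aw => ?; rewrite !mulr_ge0 ?(ltW e0) ?(ltW b0)//; lra.
    by rewrite /c; lra.
  - rewrite (mem_set Bw) (memNset Aw) !(mulr1, mulr0, subr0, sub0r).
    have ea : 0 <= e * a * (2 * (U w - q - e) + (e + e - e * a)).
      have ea : e * a <= e by rewrite ler_piMr// ltW.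
      by move: e0 (UB Bw) => ? ?; rewrite !mulr_ge0 ?(ltW e0) ?(ltW a0)//; lra.
    by lra.
apply: (le_lt_trans h).
rewrite RintegralB_bounded//; last 2 first.
- by apply: bounded_rvD => //; exact: bounded_rvX2.
- exact: (bounded_rvM (bounded_rv_cst _)).
rewrite RintegralD_bounded//; last exact: bounded_rvX2.
rewrite Rintegral_bump addr0 RintegralZ_bounded// Rintegral_indic// -/a.
by rewrite gtrDl oppr_lt0 /c !mulr_gt0.
Qed.

End Transfer.
End BoundedVariables.

(** * Failure of comonotonicity and gap events *)

Section Gap.
Context {d : measure_display} {T : measurableType d} {R : realType}.
Variable P : probability T R.
Implicit Types (U V : T -> R).

Definition gap_set U V (q r e : R) : set T :=
  [set w | U w <= q - e] `&` [set w | r + e <= V w].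

Lemma measurable_gap_set U V q r e : measurable_fun setT U ->
  measurable_fun setT V -> measurable (gap_set U V q r e).
Proof.
move=> mU mV; apply: measurableI; rewrite -[X in measurable X]setTI.
- exact: measurable_fun_le.
- exact: measurable_fun_le.
Qed.

(** Thresholds are chosen rational and margins of the form [1 / (k + 1)], so that countably many
    pairs of gap events capture every discordant pair of points. *)
Lemma gap_set_separates U V w1 w2 :
  (U w2 - U w1) * (V w2 - V w1) < 0 -> U w1 < U w2 ->
  exists (q r : rat) (k : nat), gap_set U V (ratr q) (ratr r) k.+1%:R^-1 w1 /\
    gap_set V U (ratr r) (ratr q) k.+1%:R^-1 w2.
Proof.
move=> UV U12; have V12 : V w2 < V w1.
  by move: UV; rewrite pmulr_rlt0 ?subr_gt0// subr_lt0.
have [q] := rat_in_itvoo U12; rewrite in_itv /= => /andP[q1 q2].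
have [r] := rat_in_itvoo V12; rewrite in_itv /= => /andP[r1 r2].
pose m := Num.min (Num.min (ratr q - U w1) (U w2 - ratr q))
                  (Num.min (ratr r - V w2) (V w1 - ratr r)).
have m0 : 0 < m by rewrite !lt_min !subr_gt0 q1 q2 r1 r2.
have [k] := ltr_add_invr m0; rewrite add0r !lt_min.
move=> /andP[/andP[k1 k2] /andP[k3 k4]]; exists q, r, k.
move: k1 k2 k3 k4; set e := _^-1 => k1 k2 k3 k4; rewrite /gap_set.
by split; split; rewrite /mkset; lra.
Qed.

Lemma negligible_setX (A B : set T) : measurable A -> measurable B ->
  P A = 0%E \/ P B = 0%E -> (P \x P)%E.-negligible (A `*` B).
Proof.
move=> mA mB PAB; exists (A `*` B); split => //; first exact: measurableX.
rewrite (product_measure1E P P mA mB).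
by case: PAB => PC; [transitivity (0 * P B)%E; [congr (_ * _)%E|exact: mul0e]|
  transitivity (P A * 0)%E; [congr (_ * _)%E|exact: mule0]].
Qed.

(** The discordant pairs are covered by the rectangles [A x B] and [B x A] over all rational
    thresholds and margins; each rectangle has a null side, and there are countably many. *)
Lemma comonotone_of_no_gap p (X : 'I_p -> T -> R) :
  (forall i, measurable_fun setT (X i)) ->
  (forall i j q r e, 0 < e ->
     P (gap_set (X i) (X j) q r e) = 0%E \/ P (gap_set (X j) (X i) r q e) = 0%E) ->
  comonotone P X.
Proof.
move=> mX noGap i j.
pose F (x : rat * rat * nat) := let: (q, r, k) := x in
  let A := gap_set (X i) (X j) (ratr q) (ratr r) k.+1%:R^-1 in
  let B := gap_set (X j) (X i) (ratr r) (ratr q) k.+1%:R^-1 in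
  (A `*` B) `|` (B `*` A).
(* The countable family is reindexed by natural numbers; a number that encodes no triple contributes
   the empty set. *)
pose G n := if @unpickle (rat * rat * nat)%type n is Some x then F x else set0.
have FG x : F x `<=` \bigcup_n G n.
  by move=> w Fw; exists (pickle x); rewrite /G ?pickleK.
apply: (@negligibleS _ _ _ _ (\bigcup_n G n)); last first.
  apply: negligible_bigcup => n; rewrite /G; case: unpickle => [[[q r] k]|]; last first.
    exact: negligible_set0.
  rewrite /F.
  have mA := measurable_gap_set (ratr q) (ratr r) k.+1%:R^-1 (mX i) (mX j).
  have mB := measurable_gap_set (ratr r) (ratr q) k.+1%:R^-1 (mX j) (mX i).
  have k0 : 0 < k.+1%:R^-1 :> R by rewrite invr_gt0.
  have PAB := noGap i j (ratr q) (ratr r) _ k0.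
  by apply: negligibleU; apply: negligible_setX => //; apply/or_comm.
move=> [w1 w2] /= /negP; rewrite -ltNge => neg.
have [U12|U12|U12] := ltgtP (X i w1) (X i w2); last first.
- by move: neg; rewrite U12 subrr mul0r ltxx.
- have neg' : (X i w1 - X i w2) * (X j w1 - X j w2) < 0.
    by move: neg; rewrite -mulrNN !opprB.
  have [q [r [k [h1 h2]]]] := gap_set_separates neg' U12.
  by apply: (FG (q, r, k)); right.
- have [q [r [k [h1 h2]]]] := gap_set_separates neg U12.
  by apply: (FG (q, r, k)); left.
Qed.

End Gap.

(** * Limits of uniformly bounded sequences *)

Section Limit.
Context {d : measure_display} {T : measurableType d} {R : realType}.
Variable P : probability T R.
Implicit Types (U : nat -> T -> R) (M c : R).

Lemma bounded_convergence U (V : T -> R) M :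
  (forall n, measurable_fun setT (U n)) -> bounded_rv V ->
  (forall n w, `|U n w| <= M) ->
  (\forall w \ae P, U ^~ w @ \oo --> V w) ->
  (fun n => \int[P]_w U n w) @ \oo --> \int[P]_w V w.
Proof.
move=> mU bV UM UV.
have [] := @dominated_convergence _ _ _ P setT measurableT
  (fun n w => (U n w)%:E) (EFin \o V) (cst M%:E).
- by move=> n; exact/measurable_EFinP.
- by apply/measurable_EFinP; case: bV.
- by apply: filterS UV => w UVw _; apply: cvg_EFin; [exact: nearW|exact: UVw].
- exact: (bounded_rv_integrable P (bounded_rv_cst M)).
- by apply: aeW => w n _ /=; rewrite lee_fin.
by move=> _ _ /=; rewrite -EFin_Rintegral_bounded// => /fine_cvg.
Qed.

(** The series of absolute increments has integral at most [c], hence is finite almost everywhere;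
    there the telescoping series converges absolutely. *)
Lemma ae_cvg_of_summable_increments U M c : 0 <= M ->
  (forall n, measurable_fun setT (U n)) -> (forall n w, `|U n w| <= M) ->
  (forall n, \int[P]_w `|U n.+1 w - U n w| <= c / (2 ^ (n + 1))%:R) ->
  exists V : T -> R, [/\ measurable_fun setT V, forall w, `|V w| <= M &
    \forall w \ae P, U ^~ w @ \oo --> V w].
Proof.
move=> M0 mU UM dU.
have bU n : bounded_rv (U n) by split => //; exists M.
pose g n w := `|U n.+1 w - U n w|.
have bg n : bounded_rv (g n) by apply: bounded_rv_norm; exact: bounded_rvB.
(* The upper limit is measurable even where the sequence diverges, and clamping it to [[- M, M]]
   gives the bound everywhere. At points of convergence neither operation changes the limit. *)
pose V w := Num.max (- M) (Num.min M (limn_sup (U ^~ w))).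
exists V; split.
- apply: measurable_maxr => //; apply: measurable_minr => //.
  apply: measurable_fun_limn_sup => // w _.
  + by exists M => _ [n _ <-]; rewrite (le_trans (ler_norm _)).
  + by exists (- M) => _ [n _ <-]; have := UM n w; rewrite ler_norml => /andP[].
- move=> w; rewrite ler_norml /V le_max lexx /= ge_max ge_min lexx /= andbT; lra.
have g0 n w : (0 <= (g n w)%:E)%E by rewrite lee_fin normr_ge0.
have gi : P.-integrable setT (fun w => \sum_(0 <= n <oo) (g n w)%:E)%E.
  apply/integrableP; split.
    apply: ge0_emeasurable_sum => [n w _ _|n _]; first exact: g0.
    by apply/measurable_EFinP; case: (bg n).
  under eq_integral do (rewrite gee0_abs; last exact: nneseries_ge0).
  rewrite integral_nneseries//; last first.
    by move=> n; apply/measurable_EFinP; case: (bg n).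
  apply: (@le_lt_trans _ _ (c / 2 ^+ 0)%:E); last exact: ltry.
  rewrite -(cvg_lim (@ereal_hausdorff R) (@cvg_geometric_eseries_half R c 0%N)).
  apply: lee_nneseries => [n _ _|n _]; first by apply: integral_ge0 => w _; exact: g0.
  by rewrite -(EFin_Rintegral_bounded P (bg n)) lee_fin; exact: dU.
have := integrable_ae measurableT gi; apply: filterS => w /(_ I) gw.
have cU : cvgn (U ^~ w).
  pose u n := U n w.
  have -> : U ^~ w = (fun=> u 0%N) \+ series (telescope u).
    by apply/funext => n; rewrite [LHS](eq_sum_telescope u n).
  apply: is_cvgD; first exact: is_cvg_cst.
  apply: normed_cvg; apply: nondecreasing_is_cvgn.
    by apply: nondecreasing_series => k _ _; exact: normr_ge0.
  exists (fine (\sum_(0 <= n <oo) (g n w)%:E)%E) => _ [n _ <-].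
  rewrite -lee_fin fineK// /series /= -sumEFin.
  by apply: nneseries_lim_ge => k _ _; exact: g0.
suff -> : V w = limn (U ^~ w) by [].
rewrite /V cvg_limn_supE//.
have h1 : limn (U ^~ w) <= M.
  by apply: limr_le => //; apply: nearW => n; rewrite (le_trans (ler_norm _)).
have h2 : - M <= limn (U ^~ w).
  by apply: limr_ge => //; apply: nearW => n; have := UM n w; rewrite ler_norml => /andP[].
by rewrite (min_r h1) (max_r h2).
Qed.

End Limit.

(** * Allocations dominating a given one, and their energy *)

Section Improvement.
Context {d : measure_display} {T : measurableType d} {R : realType}.
Variables (P : probability T R) (p : nat) (X : T -> R) (M : R).
Implicit Types (Y Z Xs : 'I_p -> T -> R).

(** The bound [M] is shared by all improvements, so that dominated convergence applies to any
    sequence of them. *)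
Definition improvement Xs Y :=
  [/\ forall i, measurable_fun setT (Y i), forall i w, `|Y i w| <= M,
      \forall w \ae P, \sum_(i < p) Y i w = X w & alloc_dominates P Y Xs].

Definition energy Y := \sum_(i < p) \int[P]_w (Y i w ^+ 2).

(** The second weight stays in the form [1 - 2^-1] to match [convexP]. *)
Definition midpoint Y Z := fun i w => 2^-1 * Y i w + (1 - 2^-1) * Z i w : R.

Lemma improvement_bounded Xs Y i : improvement Xs Y -> bounded_rv (Y i).
Proof. by move=> [mY YM _ _]; split => //; exists M. Qed.

Lemma improvement_trans Xs Y Z :
  improvement Xs Y -> improvement Y Z -> improvement Xs Z.
Proof.
move=> [_ _ _ YX] [mZ ZM ZX ZY]; split => // i.
exact: dominates_trans (ZY i) (YX i).
Qed.

Lemma improvement_midpoint Xs Y Z : (forall i, bounded_rv (Xs i)) ->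
  improvement Xs Y -> improvement Xs Z -> improvement Xs (midpoint Y Z).
Proof.
move=> bX iY iZ; have bY i := improvement_bounded i iY.
have bZ i := improvement_bounded i iZ.
have bm i : bounded_rv (midpoint Y Z i).
  by apply: bounded_rvD; exact: (bounded_rvM (bounded_rv_cst _)).
case: (iY) (iZ) => [mY YM sY domY] [mZ ZM sZ domZ]; split.
- by move=> i; case: (bm i).
- move=> i w; have := YM i w; have := ZM i w.
  by rewrite !ler_norml /midpoint => /andP[? ?] /andP[? ?]; apply/andP; split; lra.
- apply: filterS2 sY sZ => w sYw sZw.
  by rewrite /midpoint big_split /= -!mulr_sumr sYw sZw; lra.
- move=> i; apply/(dominates_bounded P (bm i) (bX i)) => phi cphi.
  have bphi (U : T -> R) (bU : bounded_rv U) : bounded_rv (fun w => phi (U w)).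
    exact: bounded_rv_convex cphi bU.
  have hY := (dominates_bounded P (bY i) (bX i)).1 (domY i) _ cphi.
  have hZ := (dominates_bounded P (bZ i) (bX i)).1 (domZ i) _ cphi.
  have hc (c : R) (U : T -> R) : bounded_rv U -> bounded_rv (fun w => c * phi (U w)).
    by move=> bU; apply: (bounded_rvM (bounded_rv_cst _)); exact: bphi.
  apply: (@le_trans _ _ (\int[P]_w (2^-1 * phi (Y i w) + (1 - 2^-1) * phi (Z i w)))).
    apply: le_Rintegral_bounded; first exact: bphi.
      by apply: bounded_rvD; exact: hc.
    by move=> w; apply: (convexP phi).1 => //; lra.
  rewrite RintegralD_bounded; [|exact: hc|exact: hc].
  rewrite !RintegralZ_bounded; [lra|exact: bphi|exact: bphi].
Qed.

(** Parallelogram identity for the Hilbert norm whose square is [energy]. *)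
Lemma energy_midpoint Y Z : (forall i, bounded_rv (Y i)) ->
  (forall i, bounded_rv (Z i)) ->
  energy (fun i w => Y i w - Z i w) =
  2 * (energy Y + energy Z) - 4 * energy (midpoint Y Z).
Proof.
move=> bY bZ; rewrite /energy -big_split /= !mulr_sumr -sumrB; apply: eq_bigr => i _.
have b1 : bounded_rv (fun w => Y i w ^+ 2) by exact: bounded_rvX2.
have b2 : bounded_rv (fun w => Z i w ^+ 2) by exact: bounded_rvX2.
have b3 : bounded_rv (fun w => midpoint Y Z i w ^+ 2).
  by apply: bounded_rvX2; apply: bounded_rvD; exact: (bounded_rvM (bounded_rv_cst _)).
have b12 := bounded_rvD b1 b2.
rewrite -RintegralD_bounded// -!RintegralZ_bounded// -RintegralB_bounded//.
- by apply: eq_Rintegral => w _; rewrite /midpoint; field.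
- exact: (bounded_rvM (bounded_rv_cst _)).
- exact: (bounded_rvM (bounded_rv_cst _)).
Qed.

Lemma energy_ge0 Y : 0 <= energy Y.
Proof. by apply: sumr_ge0 => i _; apply: Rintegral_ge0 => w _; exact: sqr_ge0. Qed.

(** A convex [phi] is continuous and bounded on [[- M, M]], so its integrals along the sequence
    converge. Domination therefore passes to the limit, and the square gives convergence of the
    energies. *)
Lemma improvement_limit Xs (U : nat -> 'I_p -> T -> R) Y :
  (forall i, bounded_rv (Xs i)) -> (forall n, improvement Xs (U n)) ->
  (forall i, measurable_fun setT (Y i)) -> (forall i w, `|Y i w| <= M) ->
  (forall i, \forall w \ae P, (fun n => U n i w) @ \oo --> Y i w) ->
  improvement Xs Y /\ (fun n => energy (U n)) @ \oo --> energy Y.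
Proof.
move=> bX iU mY YM UY.
have bY i : bounded_rv (Y i) by split => //; exists M.
have bU n i := improvement_bounded i (iU n).
have UM n i w : `|U n i w| <= M by case: (iU n).
have cvg_phi phi : convex_function [set: R^o] phi -> forall i,
    (fun n => \int[P]_w phi (U n i w)) @ \oo --> \int[P]_w phi (Y i w).
  move=> cphi i; have [K hK] := convex_bounded M cphi.
  apply: (@bounded_convergence _ _ _ P (fun n w => phi (U n i w)) (fun w => phi (Y i w)) K).
  - by move=> n; have [] := bounded_rv_convex cphi (bU n i).
  - exact: (bounded_rv_convex cphi (bY i)).
  - by move=> n w; exact: hK.
  - apply: filterS (UY i) => w h.
    by apply: continuous_cvg h; exact: convex_continuous.
split; last first.
  apply: cvg_big => [|i _]; first exact: add_continuous.
  exact: (cvg_phi _ convex_sqr).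
split => //.
- have sU : \forall w \ae P, forall n, \sum_(i < p) U n i w = X w.
    by apply: ae_foralln => n; case: (iU n).
  have UYw : \forall w \ae P, forall i, (fun n => U n i w) @ \oo --> Y i w.
    exact: filter_forall.
  apply: filterS2 sU UYw => w sUw cw.
  have h : (fun n => \sum_(i < p) U n i w) @ \oo --> \sum_(i < p) Y i w.
    by apply: cvg_big => [|i _]; [exact: add_continuous|exact: cw].
  have E : (fun n => \sum_(i < p) U n i w) = cst (X w) by apply/funext => n; exact: sUw.
  by rewrite E in h; apply: (cvg_unique _ h) => //; exact: cvg_cst.
- move=> i; apply/(dominates_bounded P (bY i) (bX i)) => phi cphi.
  apply: (cvgr_to_le (cvg_phi _ cphi i)); apply: nearW => n.
  apply: (dominates_bounded P (bU n i) (bX i)).1 => //.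
  by case: (iU n).
Qed.

(* Improvements are stable under midpoints, so by the parallelogram identity the
   increments of a minimizing sequence with energies within [4^-n] of the infimum have
   squared [L^2] norm at most [4 * 4^-n]; with [2 |D| <= 2^n D^2 + 2^-n] they are summable
   in [L^1], hence the sequence converges almost surely. *)
Lemma exists_energy_minimizer Xs Y0 : 0 <= M -> (forall i, bounded_rv (Xs i)) ->
  improvement Xs Y0 ->
  exists Y, improvement Xs Y /\ forall Z, improvement Xs Z -> energy Y <= energy Z.
Proof.
move=> M0 bX iY0.
pose S := [set energy Y | Y in improvement Xs].
have Slb : has_lbound S by exists 0 => _ [Y _ <-]; exact: energy_ge0.
have hS : has_inf S by split => //; exists (energy Y0), Y0.
pose m := inf S.
have mS Y : improvement Xs Y -> m <= energy Y.
  by move=> iY; apply: ge_inf => //; exists Y.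
pose eps n : R := geometric 1 4^-1 n.
have eps0 n : 0 < eps n by rewrite /eps /geometric /= mul1r exprn_gt0// invr_gt0.
have /choice[U hU] : forall n, exists Y, improvement Xs Y /\ energy Y < m + eps n.
  by move=> n; have [_ [Y iY <-] lt] := inf_adherent (eps0 n) hS; exists Y.
have iU n := (hU n).1.
have bU n i := improvement_bounded i (iU n).
have UM n i w : `|U n i w| <= M by case: (iU n).
(* With [k = 2^n], the estimate is [k / 2 * (4 / k^2) + 1 / (2 * k) = 5 / (2 * k)], whence the
   constant 5 over [2^(n + 1)]. *)
have dU i n : \int[P]_w `|U n.+1 i w - U n i w| <= 5 / (2 ^ (n + 1))%:R.
  pose D i w := U n.+1 i w - U n i w.
  have bD j : bounded_rv (D j) by exact: bounded_rvB.
  pose k : R := 2 ^+ n.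
  have k0 : 0 < k by rewrite exprn_gt0.
  have epsE : eps n = k^-1 * k^-1.
    by rewrite /eps /geometric /= mul1r -expr2 -exprVn exprAC /k exprVn -exprVn; congr (_ ^+ _); lra.
  have epsS : eps n.+1 <= eps n.
    by rewrite /eps /geometric /= !mul1r exprS ger_pMl ?exprn_gt0//; lra.
  have eD : energy D <= 4 * eps n.
    rewrite energy_midpoint//.
    have := mS _ (improvement_midpoint bX (iU n.+1) (iU n)).
    by have := (hU n).2; have := (hU n.+1).2; lra.
  have Di : \int[P]_w (D i w ^+ 2) <= energy D.
    rewrite /energy (bigD1 i)//= lerDl; apply: sumr_ge0 => j _.
    by apply: Rintegral_ge0 => w _; exact: sqr_ge0.
  have bD2 := bounded_rvX2 (bD i).
  apply: (@le_trans _ _ (\int[P]_w (k / 2 * D i w ^+ 2 + k^-1 / 2))).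
    apply: le_Rintegral_bounded; first exact: (bounded_rv_norm (bD i)).
      by apply: bounded_rvD; [exact: (bounded_rvM (bounded_rv_cst _))|exact: bounded_rv_cst].
    move=> w; rewrite -/(D i w) -real_normK ?num_real//.
    have : 0 <= (k * `|D i w| - 1) ^+ 2 / k by rewrite divr_ge0 ?sqr_ge0 ?ltW.
    have -> : (k * `|D i w| - 1) ^+ 2 / k = k * `|D i w| ^+ 2 - 2 * `|D i w| + k^-1.
      by field; lra.
    by lra.
  rewrite RintegralD_bounded; last 2 first.
  - exact: (bounded_rvM (bounded_rv_cst _)).
  - exact: bounded_rv_cst.
  rewrite RintegralZ_bounded// Rintegral_cst// [fine _](_ : _ = 1) ?mulr1; last first.
    by rewrite [X in fine X](_ : _ = 1%E)//; exact: probability_setT.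
  have -> : (2 ^ (n + 1))%:R = k * 2 :> R by rewrite natrX exprD expr1.
  apply: (@le_trans _ _ (k / 2 * (4 * (k^-1 * k^-1)) + k^-1 / 2)).
    by rewrite lerD2r ler_pM2l ?divr_gt0// -epsE (le_trans Di).
  by rewrite le_eqVlt; apply/orP; left; apply/eqP; field; lra.
have /choice[Y hY] : forall i, exists V : T -> R, [/\ measurable_fun setT V,
    forall w, `|V w| <= M & \forall w \ae P, (fun n => U n i w) @ \oo --> V w].
  move=> i; apply: (@ae_cvg_of_summable_increments _ _ _ P (fun n w => U n i w) M 5) => //.
  by move=> n; case: (bU n i).
have [] := @improvement_limit Xs U Y bX iU.
- by move=> i; case: (hY i).
- by move=> i; case: (hY i).
- by move=> i; case: (hY i).
move=> iY eY; exists Y; split => // Z iZ.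
apply: le_trans (mS _ iZ); rewrite -[leRHS]addr0.
apply: (ler_cvg_to eY (g := fun n => m + eps n)).
- apply: cvgD; first exact: cvg_cst.
  by apply: cvg_geometric; rewrite ger0_norm; lra.
- by apply: nearW => n; rewrite ltW//; exact: (hU n).2.
Qed.

(** The two strict inequalities serve different ends: the one for component [i] yields strict
    domination, the one for the energy contradicts minimality. *)
Lemma improvement_of_gap Y i j q r e : 0 < e -> (forall i, measurable_fun setT (Y i)) ->
  (forall i w, `|Y i w| <= M) -> (\forall w \ae P, \sum_(i < p) Y i w = X w) ->
  P (gap_set (Y i) (Y j) q r e) <> 0%E -> P (gap_set (Y j) (Y i) r q e) <> 0%E ->
  exists Z, [/\ improvement Y Z, \int[P]_w (Z i w ^+ 2) < \int[P]_w (Y i w ^+ 2) &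
    energy Z < energy Y].
Proof.
move=> e0 mY YM sY.
set A := gap_set _ _ _ _ _; set B := gap_set _ _ _ _ _ => PA PB.
have bY k : bounded_rv (Y k) by split => //; exists M.
have mA : measurable A by exact: measurable_gap_set.
have mB : measurable B by exact: measurable_gap_set.
have pos (C : set T) : P C <> 0%E -> (0 < P C)%E.
  by move=> /eqP PC; rewrite lt_neqAle eq_sym PC measure_ge0.
have ne (C : set T) : P C <> 0%E -> C !=set0.
  by move=> PC; apply/set0P/eqP => C0; apply: PC; rewrite C0 measure0.
have Ane := ne _ PA; have Bne := ne _ PB.
(* If [i = j], a point of [A] forces [r + 2 * e <= q] and a point of [B] forces [q + 2 * e <= r]. *)
have ij : i != j.
  apply/eqP => ij; case: Ane Bne => [w1 []] /=; rewrite -ij => ? ? [w2 []] /=.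
  by rewrite -ij; lra.
have iA w : A w -> Y i w <= q - e by case.
have iB w : B w -> q + e <= Y i w by case.
have jA w : A w -> r + e <= Y j w by case.
have jB w : B w -> Y j w <= r - e by case.
(* For [j] the events exchange roles, so the increments of components [i] and [j] are opposite and
   the sum is unchanged. *)
pose Z k := if k == i then transfer P (Y i) A B e
            else if k == j then transfer P (Y j) B A e else Y k.
have Zi : Z i = transfer P (Y i) A B e by rewrite /Z eqxx.
have Zj : Z j = transfer P (Y j) B A e by rewrite /Z eq_sym (negbTE ij) eqxx.
have Zk k : k != i -> k != j -> Z k = Y k by rewrite /Z => /negbTE -> /negbTE ->.
have ZM k w : `|Z k w| <= M.
  rewrite /Z; case: ifPn => _; last case: ifPn => _ //.
  - apply: (transfer_bounded_by P mA mB e0 iA iB) => // v; exact: YM.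
  - apply: (transfer_bounded_by P mB mA e0 jB jA) => // v; exact: YM.
have mZ k : measurable_fun setT (Z k).
  rewrite /Z; case: ifPn => _; last case: ifPn => _ //.
  - by have [] := bounded_rv_transfer P e (bY i) mA mB.
  - by have [] := bounded_rv_transfer P e (bY j) mB mA.
have bZ k : bounded_rv (Z k) by split => //; exists M.
have dom : alloc_dominates P Z Y.
  move=> k; rewrite /Z; case: eqP => [->|_]; last case: eqP => [->|_].
  - exact: (transfer_dominates P (bY i) mA mB e0 iA iB).
  - exact: (transfer_dominates P (bY j) mB mA e0 jB jA).
  - exact: dominates_refl.
have lti : \int[P]_w (Z i w ^+ 2) < \int[P]_w (Y i w ^+ 2).
  by rewrite Zi; apply: (transfer_sqr_lt (bY i) mA mB e0 iA iB); exact: pos.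
exists Z; split => //.
- split => //; apply: filterS sY => w <-.
  rewrite (bigD1 i)//= (bigD1 j) 1?eq_sym//= [RHS](bigD1 i)//= [in RHS](bigD1 j) 1?eq_sym//=.
  rewrite Zi Zj /transfer !addrA; congr (_ + _); first ring.
  by apply: eq_bigr => k /andP[ki kj]; rewrite Zk.
(* Component [i] decreases strictly; the others do not increase, by domination tested on the
   square. *)
- rewrite /energy (bigD1 i)//= [ltRHS](bigD1 i)//= ltr_leD//.
  apply: ler_sum => k _.
  exact: ((dominates_bounded P (bZ k) (bY k)).1 (dom k) _ convex_sqr).
Qed.

End Improvement.

(** * Bounded representatives, almost sure equality, and the theorem *)

Section Conclusion.
Context {d : measure_display} {T : measurableType d} {R : realType}.
Variables (P : probability T R) (p : nat) (X : T -> R).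
Implicit Types (Y Z Xs : 'I_p -> T -> R).

(** Clamping every component at a common essential bound alters it only on a null set and makes it
    bounded everywhere. The self-improvement packs measurability, the bound and the sum
    condition. *)
Lemma exists_truncation Xs : allocation P X Xs ->
  exists M Y, [/\ 0 <= M, improvement P X M Y Y &
    forall i, \forall w \ae P, Y i w = Xs i w].
Proof.
move=> [LX sX].
have /choice[N hN] : forall i, exists N, \forall w \ae P, `|Xs i w| <= N.
  by move=> i; have [] := Lfun_bounded (LX i).
pose M := \sum_(i < p) `|N i|.
have M0 : 0 <= M by exact: sumr_ge0.
pose Y i w := Num.max (- M) (Num.min M (Xs i w)).
have YX i : \forall w \ae P, Y i w = Xs i w.
  apply: filterS (hN i) => w XN.
  have : `|Xs i w| <= M.
    rewrite (le_trans XN)// (le_trans (ler_norm _))// /M (bigD1 i)//= lerDl.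
    exact: sumr_ge0.
  by rewrite ler_norml /Y => /andP[h1 h2]; rewrite (min_r h2) (max_r h1).
exists M, Y; split => //; split.
- move=> i; have [mX _] := Lfun_bounded (LX i).
  by apply: measurable_maxr => //; exact: measurable_minr.
- move=> i w; rewrite ler_norml /Y le_max lexx /= ge_max ge_min lexx /= andbT; lra.
- have YXw : \forall w \ae P, forall i, Y i w = Xs i w by exact: filter_forall.
  by apply: filterS2 sX YXw => w <- E; apply: eq_bigr => i _; rewrite E.
- by move=> i; exact: dominates_refl.
Qed.

Lemma gap_of_not_comonotone Y : (forall i, measurable_fun setT (Y i)) ->
  ~ comonotone P Y -> exists i j q r e, [/\ 0 < e,
    P (gap_set (Y i) (Y j) q r e) <> 0%E & P (gap_set (Y j) (Y i) r q e) <> 0%E].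
Proof.
move=> mY nc; apply: contrapT => ngap; apply: nc.
apply: comonotone_of_no_gap => // i j q r e e0.
apply: contrapT => /not_orP[PA PB].
by apply: ngap; exists i, j, q, r, e.
Qed.

Lemma ae_prod (Q : T -> Prop) : (\forall w \ae P, Q w) ->
  \forall w \ae (P \x P)%E, Q w.1 /\ Q w.2.
Proof.
move=> [N [mN PN QN]].
apply: (@negligibleS _ _ _ _ (N `*` setT `|` setT `*` N)).
  move=> [w1 w2] /= /not_andP[] nQ; [left|right]; split => //; exact: QN.
by apply: negligibleU; apply: negligible_setX => //; [left|right].
Qed.

Lemma comonotone_ae_eq Y Z : (forall i, \forall w \ae P, Y i w = Z i w) ->
  comonotone P Y -> comonotone P Z.
Proof.
move=> YZ cY i j.
by apply: filterS3 (cY i j) (ae_prod (YZ i)) (ae_prod (YZ j)) => w + [<- <-] [<- <-].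
Qed.

Lemma allocation_of_improvement M Xs Y : improvement P X M Xs Y -> allocation P X Y.
Proof.
move=> iY; split; last by case: iY.
by move=> i; apply: bounded_rv_Lfun; exact: (improvement_bounded i iY).
Qed.

End Conclusion.

Theorem theorem3p1 (d : measure_display) (T : measurableType d) (R : realType)
    (P : probability T R) (P_non_atomic : non_atomic P)
    (p : nat) (p_ge1 : (1 <= p)%N)
    (X : T -> R) (X_bounded : X \in Lfun P +oo%E)
    (Xs : 'I_p -> T -> R) (Xs_alloc : allocation P X Xs) :
  (exists Y : 'I_p -> T -> R,
     [/\ allocation P X Y, comonotone P Y & alloc_dominates P Y Xs]) /\
  (~ comonotone P Xs ->
   exists Y : 'I_p -> T -> R,
     allocation P X Y /\ alloc_strictly_dominates P Y Xs).
Proof.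
have [M [Y0 [M0 iY0 Y0X]]] := exists_truncation Xs_alloc.
have mXs i : measurable_fun setT (Xs i).
  by have [mX _] := Lfun_bounded (Xs_alloc.1 i).
have bY0 i := improvement_bounded i iY0.
have mY0 i : measurable_fun setT (Y0 i) by case: (bY0 i).
(* The argument runs on the truncation [Y0]; domination passes to [Xs] by almost sure equality. *)
have domX Y : improvement P X M Y0 Y -> alloc_dominates P Y Xs.
  by move=> [_ _ _ dY] i; exact: (dominates_ae_eqr (mY0 i) (mXs i) (Y0X i) (dY i)).
split.
  have [Y [iY minY]] := exists_energy_minimizer M0 bY0 iY0.
  exists Y; split; [exact: allocation_of_improvement iY| |exact: domX].
  apply: contrapT => nc; have [mY YM sY _] := iY.
  have [i [j [q [r [e [e0 PA PB]]]]]] := gap_of_not_comonotone mY nc.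
  have [Z [iZ _]] := improvement_of_gap e0 mY YM sY PA PB.
  by rewrite ltNge (minY _ (improvement_trans iY iZ)).
move=> nc; have [_ Y0M sY0 _] := iY0.
have nc0 : ~ comonotone P Y0 by move=> /(comonotone_ae_eq Y0X).
have [i [j [q [r [e [e0 PA PB]]]]]] := gap_of_not_comonotone mY0 nc0.
have [Z [iZ lt _]] := improvement_of_gap e0 mY0 Y0M sY0 PA PB.
exists Z; split; first exact: allocation_of_improvement iZ.
split; first exact: domX.
exists i; split; first exact: domX.
exists (fun x => x ^+ 2); split; first exact: convex_sqr.
have bZ := bounded_rv_convex convex_sqr (improvement_bounded i iZ).
have bY := bounded_rv_convex convex_sqr (bY0 i).
(* [Xs i] may be unbounded on a null set, so it is replaced by [Y0 i], whose second moment is a real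
   integral. *)
rewrite -(@expectation_ae_eq _ _ _ P ((fun x => x ^+ 2) \o Y0 i) ((fun x => x ^+ 2) \o Xs i)).
- by rewrite !expectation_bounded_rv// lte_fin.
- by case: bY.
- by apply: measurableT_comp => //; exact: (convex_measurable convex_sqr).
- by apply: filterS (Y0X i) => w /= ->.
Qed.
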